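(* Let $\{b_k\}_{k=1}^{\infty}$ be a sequence of integers with $|b_k|\ge 2$ for all $k$, let $\{N_k\}_{k=1}^\infty$ be a sequence of integers with $N_k\ge 2$, let $\{t_k\}_{k=1}^\infty$ be a sequence of integers with $|t_k|\ge 1$, and put $D_k=\{0,1,\dots,N_k-1\}\,t_k=\{0,t_k,2t_k,\dots,(N_k-1)t_k\}$. For $k\ge 1$ let $$\mu_k=\delta_{b_1^{-1}D_1}\ast\delta_{b_1^{-1}b_2^{-1}D_2}\ast\cdots\ast\delta_{b_1^{-1}b_2^{-1}\cdots b_k^{-1}D_k}.$$ If $$\sum_{k=1}^{\infty}\left|\frac{N_kt_k}{b_1b_2\cdots b_k}\right|<\infty ,$$ then $\mu_k$ converges weakly to a Borel probability measure on $\mathbb{R}$ as $k\to\infty$. Moreover, if $b_k\ge 2$ and $t_k\ge 1$ for all $k$, then the converse is also true: if $\mu_k$ converges weakly to a Borel probability measure, then $\sum_{k=1}^{\infty}\frac{N_kt_k}{b_1b_2\cdots b_k}<\infty$.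
   Context: For a finite set $E\subset\mathbb{R}$, $\delta_E=\frac{1}{\#E}\sum_{e\in E}\delta_e$, where $\delta_e$ is the Dirac point mass at $e$; $cE=\{ce:e\in E\}$; $\ast$ is convolution of measures. $\mu_k$ converges weakly to $\mu$ if $\int f\,d\mu_k\to\int f\,d\mu$ for every bounded continuous $f:\mathbb{R}\to\mathbb{C}$. *)

(* Defs.v *)
From HB Require Import structures.
From mathcomp Require Import all_boot all_order all_algebra finmap.
From mathcomp Require Import all_classical all_reals all_analysis.
From mathcomp Require Import complex.
Set Implicit Arguments.
Unset Strict Implicit.
Unset Printing Implicit Defensive.
Import Order.TTheory GRing.Theory Num.Theory.
Import numFieldNormedType.Exports.
Local Open Scope classical_set_scope.
Local Open Scope ring_scope.

Section uniform_on.
Variables (R : realType) (E : {fset R}).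

(* A realType carries its Borel sigma-algebra as canonical measurable
   structure; for E empty this is the zero measure. *)
Definition uniform_on (A : set R) : \bar R :=
  (((#|` E|)%:R^-1)%:E * \sum_(e <- E) \d_e A)%E.

Let w : {nonneg R} := ((#|` E|)%:R^-1)%:nng.

Let m : {measure set R -> \bar R} :=
  mscale w (msum (fun k => \d_(nth 0 E k) : {measure set R -> \bar R}) #|` E|).

Let uniform_onE : uniform_on = m.
Proof.
apply/funext => A; rewrite /uniform_on /m /= /mscale /msum /=.
by rewrite (big_nth 0) big_mkord.
Qed.

Let uniform_on0 : uniform_on set0 = 0%E.
Proof. by rewrite uniform_onE measure0. Qed.

Let uniform_on_ge0 A : (0 <= uniform_on A)%E.
Proof. by rewrite uniform_onE measure_ge0. Qed.

Let uniform_on_sigma_additive : semi_sigma_additive uniform_on.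
Proof. by rewrite uniform_onE; exact: measure_semi_sigma_additive. Qed.

HB.instance Definition _ := isMeasure.Build _ _ _ uniform_on
  uniform_on0 uniform_on_ge0 uniform_on_sigma_additive.

Let uniform_on_fin : fin_num_fun uniform_on.
Proof.
move=> A mA; rewrite /uniform_on fin_numM //.
by apply/sum_fin_numP => e _ _; rewrite diracE.
Qed.

HB.instance Definition _ :=
  Measure_isFinite.Build _ _ _ uniform_on uniform_on_fin.

End uniform_on.

Section convolution.
Variable R : realType.
Variables mu nu : {finite_measure set R -> \bar R}.

Definition convolution : set R -> \bar R :=
  pushforward (mu \x nu)%E (fun z => z.1 + z.2).

Let madd : measurable_fun setT (fun z : R * R => z.1 + z.2).
Proof. by apply: measurable_realfun.measurable_funD. Qed.

Let convolution0 : convolution set0 = 0%E.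
Proof. by rewrite /convolution /pushforward preimage_set0 measure0. Qed.

Let convolution_ge0 A : (0 <= convolution A)%E.
Proof. exact: measure_ge0. Qed.

Let convolution_sigma_additive : semi_sigma_additive convolution.
Proof.
by apply: measure_semi_sigma_additive; exact: madd.
Qed.

HB.instance Definition _ := isMeasure.Build _ _ _ convolution
  convolution0 convolution_ge0 convolution_sigma_additive.

Let convolution_fin : fin_num_fun convolution.
Proof.
move=> A mA; rewrite ge0_fin_numE //.
apply: (@le_lt_trans _ _ (convolution setT)).
  by apply: le_measure => //; rewrite inE.
rewrite /convolution /pushforward preimage_setT -setXTT product_measure1E //.
by rewrite -ge0_fin_numE ?mule_ge0 // fin_numM // fin_num_measure.
Qed.

HB.instance Definition _ :=
  Measure_isFinite.Build _ _ _ convolution convolution_fin.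

End convolution.

Section weak_convergence.
Variable R : realType.

Definition complex_integral (mu : {finite_measure set R -> \bar R})
    (f : R -> R[i]) : R[i] :=
  ((\int[mu]_x complex.Re (f x)) +i* (\int[mu]_x complex.Im (f x)))%C.

(* R[i]^o is R[i] with the topology of its norm. *)
Definition weakly_converges (nu : nat -> {finite_measure set R -> \bar R})
    (mu : {finite_measure set R -> \bar R}) : Prop :=
  forall f : R -> R[i],
    continuous (f : R -> R[i]^o) ->
    (exists M : R, forall x, `|f x| <= M%:C%C) ->
    (complex_integral (nu k) f : R[i]^o) @[k --> \oo]
      --> (complex_integral mu f : R[i]^o).

End weak_convergence.

(* Sequences are indexed from 0: b k, N k and t k are the usual b_{k+1},
   N_{k+1} and t_{k+1}, and partial_conv R b N t k is the measure mu_{k+1}. *)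
Section Cantor_convolution.
Variable R : realType.
Variables (b : nat -> int) (N : nat -> nat) (t : nat -> int).

Definition scale_fset (c : R) (E : {fset R}) : {fset R} :=
  [fset c * e | e in E]%fset.

Definition digit_set (k : nat) : {fset R} :=
  [fset (j%:R : R) * (t k)%:~R | j in iota 0 (N k)]%fset.

Definition base_prod (k : nat) : R := \prod_(i < k.+1) (b i)%:~R.

Definition conv_factor (k : nat) : {finite_measure set R -> \bar R} :=
  uniform_on (scale_fset (base_prod k)^-1 (digit_set k)).

Fixpoint partial_conv (k : nat) : {finite_measure set R -> \bar R} :=
  if k is k'.+1 then convolution (partial_conv k') (conv_factor k'.+1)
  else conv_factor 0.

End Cantor_convolution.

(* Main.v *)
(* mu_k is the law of a sum X_0 + ... + X_k of independent variables, X_i being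
   uniform on {0, ..., N_i - 1} s_i with s_i = t_i / (b_0 ... b_i).
   Sufficiency: take for the X_i / s_i the digits, in the Cantor series
   expansion with bases N_i, of a point drawn uniformly in [0, 1[. The sums
   then converge pointwise by comparison with \sum N_i |s_i|, and the law of
   the limit is the weak limit, by dominated convergence.
   Necessity: test the convergence against exp(-|x|). As all X_i are
   nonnegative, L_k = \int exp(-|x|) d mu_k is the product of the E exp(-X_i),
   and E exp(-X_i) <= 1 - g_i with g_i = c_i / (4 (1 + c_i)), c_i = N_i s_i.
   L_k decreases to a limit l > 0, so l \sum g_i telescopes to at most 1; hence
   g_i tends to 0 and c_i is eventually at most 8 g_i. *)
Require Import Defs.
From HB Require Import structures.
From mathcomp Require Import all_boot all_order all_algebra finmap.
From mathcomp Require Import all_classical all_reals all_analysis.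
From mathcomp Require Import complex.
From mathcomp Require Import measurable_realfun ring lra.
Set Implicit Arguments.
Unset Strict Implicit.
Unset Printing Implicit Defensive.
Import Order.TTheory GRing.Theory Num.Theory.
Import numFieldNormedType.Exports.
Local Open Scope classical_set_scope.
Local Open Scope ring_scope.

(** * Uniform laws on finite lists of reals *)

(** A list rather than a set, because different choices of digits may give the same sum and the
    multiplicity counts. *)
Definition uniform_atoms (R : realType) (mu : set R -> \bar R) (s : seq R) :=
  forall A, measurable A -> mu A = ((size s)%:R^-1%:E * \sum_(x <- s) \d_x A)%E.

Lemma ge0_integral_uniform_atoms (R : realType)
    (mu : {measure set R -> \bar R}) (s : seq R) (f : R -> \bar R) :
  uniform_atoms mu s -> measurable_fun setT f -> (forall x, 0 <= f x)%E ->
  (\int[mu]_x f x = (size s)%:R^-1%:E * \sum_(x <- s) f x)%E.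
Proof.
move=> mus mf f0.
have w0 : 0 <= (size s)%:R^-1 :> R by rewrite invr_ge0.
pose w := NngNum w0.
pose m := mscale w
  (msum (fun k => \d_(nth 0 s k) : {measure set R -> \bar R}) (size s)).
rewrite (@eq_measure_integral _ _ _ setT m); last first.
  move=> A mA _; rewrite mus// /m /mscale/= /msum.
  by rewrite (big_nth 0) big_mkord.
rewrite /m ge0_integral_mscale//; congr (_ * _)%E.
rewrite ge0_integral_measure_sum// (big_nth 0) big_mkord.
by apply: eq_bigr => i _; rewrite integral_dirac// diracT mul1e.
Qed.

Lemma uniform_on_atoms (R : realType) (E : {fset R}) (s : seq R) :
  perm_eq E s -> uniform_atoms (uniform_on E) s.
Proof.
move=> Es A mA; rewrite /= /uniform_on (perm_big _ Es)/=.
by rewrite -(perm_size Es).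
Qed.

(** Computing the product measure through its sections turns the two averages into one average over
    all pairs; coinciding sums are simply repeated in the list. *)
Lemma convolution_atoms (R : realType)
    (mu nu : {finite_measure set R -> \bar R}) (s s' : seq R) :
  uniform_atoms mu s -> uniform_atoms nu s' ->
  uniform_atoms (convolution mu nu) [seq x + y | x <- s, y <- s'].
Proof.
move=> mus nus' A mA.
have madd : measurable_fun setT (fun z : R * R => z.1 + z.2).
  exact: measurable_funD.
have mB : measurable ((fun z : R * R => z.1 + z.2) @^-1` A).
  by rewrite -[X in measurable X]setTI; exact: madd.
rewrite /= /convolution /pushforward /product_measure1.
rewrite (ge0_integral_uniform_atoms mus)//=; last exact: measurable_fun_xsection.
rewrite size_allpairs natrM invfM EFinM -muleA; congr (_ * _)%E.
rewrite big_allpairs_dep ge0_sume_distrr; last first.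
  by move=> x _; rewrite sume_ge0// => y _; exact: measure_ge0.
apply: eq_bigr => x _; rewrite nus'; last exact: measurable_xsection.
congr (_ * _)%E; apply: eq_bigr => y _; rewrite !diracE; congr (_%:R%:E).
by congr nat_of_bool; apply/idP/idP; rewrite !inE /xsection/= !inE.
Qed.

(** As [c] and [t] are nonzero, the points [j * t * c] are distinct, so no digit is lost in passing
    to finite sets. *)
Lemma perm_scale_digit_set (R : realType) (c : R) (t : int) (n : nat) :
  c != 0 -> t != 0 ->
  perm_eq (scale_fset c [fset (j%:R : R) * t%:~R | j in iota 0 n]%fset)
    [seq j%:R * (t%:~R * c) | j <- iota 0 n].
Proof.
move=> c0 t0; apply: uniq_perm; first exact: fset_uniq.
  rewrite map_inj_uniq ?iota_uniq// => i j /(mulIf _) /eqP.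
  by rewrite eqr_nat => H; apply/eqP; apply: H; rewrite mulf_neq0// intr_eq0.
move=> x; apply/imfsetP/mapP => /=.
  move=> [y /imfsetP[j /= jn ->] ->]; exists j => //.
  by rewrite mulrC mulrA.
move=> [j jn ->]; exists (j%:R * t%:~R); last by rewrite [RHS]mulrC mulrA.
by apply/imfsetP; exists j.
Qed.

(** * Digit sums and the Cantor series coding of a point *)

Section digit_sums.
Variables (R : realType) (N : nat -> nat) (s : nat -> R).

Definition digits k : seq R := [seq j%:R * s k | j <- iota 0 (N k)].

(** The last digit varies fastest in this enumeration: a position in the list is a mixed-radix
    integer whose least significant digit is the one of place [k]. *)
Fixpoint digit_sums k : seq R :=
  if k is k'.+1 then [seq x + y | x <- digit_sums k', y <- digits k]
  else digits 0.

Definition radix k : nat := \prod_(i < k.+1) N i.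

Lemma radix0 : radix 0 = N 0%N.
Proof. by rewrite /radix big_ord_recl big_ord0 muln1. Qed.

Lemma radixS k : radix k.+1 = (radix k * N k.+1)%N.
Proof. by rewrite /radix big_ord_recr. Qed.

Lemma size_digits k : size (digits k) = N k.
Proof. by rewrite size_map size_iota. Qed.

Lemma size_digit_sums k : size (digit_sums k) = radix k.
Proof.
elim: k => [|k IHk]; first by rewrite size_digits radix0.
by rewrite /= size_allpairs IHk size_digits radixS.
Qed.

Lemma nth_digits k j : (j < N k)%N -> nth 0 (digits k) j = j%:R * s k.
Proof. by move=> jN; rewrite (nth_map 0%N) ?size_iota// nth_iota. Qed.

(* The digit of [w] at place [k] in the Cantor series expansion
   [w = \sum_k d_k / (N_0 ... N_k)]. *)
Definition digit k (w : R) : nat := (Num.truncn (w * (radix k)%:R) %% N k)%N.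

Definition coding k (w : R) : R := \sum_(i < k.+1) (digit i w)%:R * s i.

Hypothesis N_gt0 : forall k, (0 < N k)%N.

Lemma radix_gt0 k : (0 < radix k)%N.
Proof. exact: prodn_gt0. Qed.

End digit_sums.

(** The list is made of consecutive rows of length [size s']: the quotient selects the row, the
    remainder the place in it. *)
Lemma nth_allpairs_add (R : nmodType) (s s' : seq R) m :
  (m < size s * size s')%N ->
  nth 0 [seq x + y | x <- s, y <- s'] m =
  nth 0 s (m %/ size s') + nth 0 s' (m %% size s').
Proof.
elim: s m => [//|x s IHs] m /=; rewrite mulSn nth_cat size_map => mlt.
case: ltnP => ms'.
  by rewrite (nth_map 0)// divn_small// modn_small.
have s'0 : (0 < size s')%N.
  by rewrite lt0n; apply: contraTneq mlt => ->; rewrite muln0.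
rewrite IHs; last by rewrite ltn_subLR.
rewrite -{3 4}(subnKC ms') divnDl ?dvdnn// divnn s'0 modnDl.
by rewrite add1n.
Qed.

(** Used to drop the last digit: the position of a point at one level yields its position at the
    previous level. *)
Lemma truncn_divn (R : realType) (x : R) (n : nat) :
  0 <= x -> (0 < n)%N -> (Num.truncn (x * n%:R)%R %/ n)%N = Num.truncn x.
Proof.
move=> x0 n0; apply/esym/truncn_def.
have xn0 : 0 <= x * n%:R by rewrite mulr_ge0.
have /andP[h1 h2] := truncn_itv xn0.
have n0' : (0 : R) < n%:R by rewrite ltr0n.
rewrite -(ler_pM2r n0') -natrM -[X in _ && X](ltr_pM2r n0') -natrM.
apply/andP; split.
  by apply: le_trans h1; rewrite ler_nat leq_trunc_div.
by apply: lt_le_trans h2 _; rewrite ler_nat ltn_ceil.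
Qed.

Section coding.
Variables (R : realType) (N : nat -> nat) (s : nat -> R).
Hypothesis N_gt0 : forall k, (0 < N k)%N.

Lemma truncn_radix_lt k (w : R) : 0 <= w < 1 ->
  (Num.truncn (w * (radix N k)%:R) < radix N k)%N.
Proof.
move=> /andP[w0 w1]; rewrite truncn_lt_nat ?mulr_ge0//.
by rewrite gtr_pMl// ltr0n radix_gt0.
Qed.

(** By induction: dividing the position at level [k.+1] by [N k.+1] gives the position at level [k]
    as quotient and the new digit as remainder. *)
Lemma coding_nth k (w : R) : 0 <= w < 1 ->
  coding N s k w = nth 0 (digit_sums N s k) (Num.truncn (w * (radix N k)%:R)).
Proof.
move=> w01; elim: k => [|k IHk].
  rewrite /coding big_ord_recl big_ord0 addr0 /= /digit.
  have := truncn_radix_lt 0 w01; rewrite radix0 => wN.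
  by rewrite nth_digits// modn_small.
have wN := truncn_radix_lt k.+1 w01; rewrite [digit_sums N s k.+1]/=.
rewrite nth_allpairs_add size_digits; last first.
  by rewrite size_digit_sums -radixS.
rewrite /coding big_ord_recr/= -/(coding N s k w) IHk nth_digits ?ltn_pmod//.
congr (nth _ _ _ + _); rewrite radixS natrM mulrA truncn_divn//.
by rewrite mulr_ge0//; case/andP: w01.
Qed.

Lemma measurable_truncn : measurable_fun setT (fun x : R => Num.truncn x).
Proof.
have mle (n : nat) : measurable [set x : R | (Num.truncn x <= n)%N].
  (* [truncn] is 0 on negative reals, so these sublevel sets are half-lines unbounded below. *)
  rewrite (_ : [set _ | _] = `]-oo, n.+1%:R[%classic)//.
  by apply/seteqP; split => x /=; rewrite in_itv/= truncn_le_nat.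
have meq (n : nat) : measurable [set x : R | Num.truncn x = n].
  case: n => [|n].
    rewrite (_ : [set _ | _] = [set x : R | (Num.truncn x <= 0)%N])//.
    by apply/seteqP; split => x /=; rewrite leqn0 => /eqP.
  rewrite (_ : [set _ | _] = [set x : R | (Num.truncn x <= n.+1)%N] `\`
      [set x : R | (Num.truncn x <= n)%N]); first exact: measurableD.
  apply/seteqP; split => x /=; first by move=> ->; rewrite leqnn ltnn.
  by move=> [h /negP]; rewrite -ltnNge => h'; apply/eqP; rewrite eqn_leq h h'.
move=> _ Y _; rewrite setTI.
rewrite (_ : _ @^-1` Y = \bigcup_(n in Y) [set x : R | Num.truncn x = n]).
  by apply: bigcup_measurable => n _.
by apply/seteqP; split => [x Yx|x [n Yn /= xn]]; [exists (Num.truncn x)|rewrite xn].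
Qed.

Lemma measurable_coding k : measurable_fun setT (coding N s k).
Proof.
apply: measurable_sum => i; apply: measurable_funM => //.
pose g (n : nat) : R := (n %% N i)%:R.
have mg : measurable_fun setT g by [].
apply: (measurableT_comp mg); apply: (measurableT_comp measurable_truncn).
exact: measurable_funM.
Qed.

End coding.

(** * The uniform law on the unit interval, and the atoms of the partial convolutions *)

Section unit_law.
Variable R : realType.

Definition unit_law : set R -> \bar R :=
  mrestr lebesgue_measure (measurable_itv `[0 : R, 1[).

Let m : {measure set (measurableTypeR R) -> \bar R} :=
  mrestr lebesgue_measure (measurable_itv `[0 : R, 1[).

(* The structure is rebuilt because [lebesgue_measure] lives on the alias
   [measurableTypeR R] of [R], whose display differs from that of [R]. *)
HB.instance Definition _ := isMeasure.Build _ R R unit_law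
  (measure0 m) (measure_ge0 m) (@measure_semi_sigma_additive _ _ _ m).

Lemma unit_law_setT : unit_law setT = 1%E.
Proof.
rewrite /unit_law /mrestr setTI lebesgue_measure_itv/= lte_fin ltr01.
by rewrite oppr0 adde0.
Qed.

HB.instance Definition _ :=
  Measure_isProbability.Build _ R R unit_law unit_law_setT.

End unit_law.

(* Cut [[0, 1[] into the intervals on which [truncn (w * size s)] is constant. *)
Lemma unit_law_atoms (R : realType) (s : seq R) (X : R -> R) :
  (0 < size s)%N -> measurable_fun setT X ->
  (forall w : R, 0 <= w < 1 -> X w = nth 0 s (Num.truncn (w * (size s)%:R))) ->
  uniform_atoms (fun A => unit_law (X @^-1` A)) s.
Proof.
set n := size s => n0 mX Xs A mA; have n0' : (0 : R) < n%:R by rewrite ltr0n.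
pose I (m : nat) : set R := `[m%:R / n%:R, m.+1%:R / n%:R[%classic.
have mI m : measurable (I m) by exact: measurable_itv.
have mXA : measurable (X @^-1` A) by rewrite -[X in measurable X]setTI; exact: mX.
have IE m (w : R) : I m w <-> 0 <= w /\ Num.truncn (w * n%:R) = m.
  rewrite /I /= in_itv/= ler_pdivrMr// ltr_pdivlMr//; split.
    move=> /andP[mw wm]; split; last by apply/truncn_def; rewrite mw wm.
    by rewrite -(pmulr_lge0 _ n0') (le_trans _ mw).
  by move=> [w0 <-]; exact/truncn_itv/mulr_ge0.
have lt1 (w : R) : 0 <= w -> (w < 1) = (Num.truncn (w * n%:R) < n)%N.
  by move=> w0; rewrite truncn_lt_nat ?mulr_ge0// gtr_pMl.
have -> : unit_law (X @^-1` A) =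
    lebesgue_measure (\big[setU/set0]_(m < n) (X @^-1` A `&` I m)).
  rewrite /unit_law /mrestr; congr (lebesgue_measure _).
  rewrite -(bigcup_mkord n (fun m => X @^-1` A `&` I m)).
  apply/seteqP; split => w /=.
    move=> [Aw]; rewrite in_itv/= => /andP[w0]; rewrite lt1// => wn.
    by exists (Num.truncn (w * n%:R)) => //; split => //; apply/IE.
  move=> [m /= mn [Aw /IE[w0 wm]]]; split => //.
  by rewrite in_itv/= w0 lt1// wm.
have -> : lebesgue_measure (\big[setU/set0]_(m < n) (X @^-1` A `&` I m)) =
    (\sum_(m < n) lebesgue_measure (X @^-1` A `&` I m))%E.
  apply (@measure_bigsetU _ _ _ (@lebesgue_measure R)
    (fun m => (X @^-1` A : set (measurableTypeR R)) `&` I m)) => [m|].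
    exact: (measurableI _ _ mXA (mI m)).
  by move=> i j _ _ [w [[_ /IE[_ wi]] [_ /IE[_ wj]]]]; rewrite -wi -wj.
rewrite ge0_sume_distrr//.
rewrite (big_nth 0) big_mkord; apply: eq_bigr => m _.
have XI w : I m w -> X w = nth 0 s m.
  by move=> /IE[w0 wm]; rewrite -wm Xs// w0 lt1// wm ltn_ord.
(* [X] is constant on [I m], so this piece is either all of [I m], of length [1 / n], or empty. *)
rewrite diracE; have [Am|Am] := boolP (nth 0 s m \in A).
  rewrite mule1 (_ : _ `&` _ = I m).
    rewrite /I lebesgue_measure_itv/= lte_fin ltr_pM2r ?invr_gt0// ltr_nat ltnSn.
    by rewrite -EFinB -mulrBl -natrB// subSnn mul1r.
  apply/seteqP; split => [w []//|w Iw]; split => //=.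
  by rewrite (XI _ Iw); exact: set_mem.
rewrite mule0 (_ : _ `&` _ = set0) ?measure0//.
apply/seteqP; split => [w [/= Aw Iw]|w []//].
by move/negP: Am; apply; rewrite -(XI _ Iw); exact: mem_set.
Qed.

Lemma partial_conv_atoms (R : realType) (b : nat -> int) (N : nat -> nat)
    (t : nat -> int) k :
  (forall k, b k != 0) -> (forall k, t k != 0) ->
  uniform_atoms (partial_conv R b N t k)
    (digit_sums N (fun i => (t i)%:~R / base_prod R b i) k).
Proof.
move=> b0 t0.
have atoms i : uniform_atoms (conv_factor R b N t i)
    (digits N (fun i => (t i)%:~R / base_prod R b i) i).
  apply: uniform_on_atoms; apply: perm_scale_digit_set => //.
  by rewrite invr_eq0; apply/prodf_neq0 => j _; rewrite intr_eq0.
by elim: k => [|k IHk] /=; [exact: atoms|exact: convolution_atoms].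
Qed.

(** * Reduction of complex test functions to real ones *)

(** Multiplication by ['i] keeps the modulus and exchanges real and imaginary parts up to sign, so
    the bound for real parts applies. *)
Lemma normc_ge_Im (R : rcfType) (z : R[i]) : `|complex.Im z|%:C%C <= `|z|.
Proof.
have := normc_ge_Re ('i%C * z); rewrite normrM [ `|'i%C| ]normc_def/=.
rewrite expr0n expr1n add0r sqrtr1 mul1r; apply: le_trans.
by case: z => x y /=; rewrite lecR mul0r mul1r add0r normrN.
Qed.

Lemma cvg_complex (R : realType) (u : nat -> R[i]) (l : R[i]) :
  complex.Re (u k) @[k --> \oo] --> complex.Re l ->
  complex.Im (u k) @[k --> \oo] --> complex.Im l ->
  (u k : R[i]^o) @[k --> \oo] --> (l : R[i]^o).
Proof.
move=> cRe cIm; apply/cvgrPdist_lt => -[e e'].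
(* Positivity in [R[i]] forces the radius to be real: [e'] is 0 and [e] is positive. *)
rewrite ltcE/= => /andP[/eqP -> e0].
have subE (z w : R[i]) : z - w = (complex.Re z - complex.Re w)%:C%C +
    'i%C * (complex.Im z - complex.Im w)%:C%C.
  by case: z w => [? ?] [? ?]; rewrite [LHS]complexE.
have e20 : 0 < e / 2 by rewrite divr_gt0.
have /cvgrPdist_lt/(_ _ e20) nRe := cRe.
have /cvgrPdist_lt/(_ _ e20) nIm := cIm.
near=> k.
have hRe : `|complex.Re l - complex.Re (u k)| < e / 2 by near: k.
have hIm : `|complex.Im l - complex.Im (u k)| < e / 2 by near: k.
rewrite subE; apply: le_lt_trans (ler_normD _ _) _.
rewrite normrM !normc_def/= !expr0n/= !addr0 add0r expr1n sqrtr1 mul1r.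
by rewrite !sqrtr_sqr -rmorphD/= ltcR; lra.
Unshelve. all: by end_near. Qed.

Lemma continuous_Re (R : realType) (f : R -> R[i]) :
  continuous (f : R -> R[i]^o) -> continuous (fun x => complex.Re (f x)).
Proof.
move=> cf x; apply/cvgrPdist_lt => e e0.
have e0' : 0 < (e%:C)%C :> R[i] by rewrite ltcR.
have /cvgrPdist_lt/(_ _ e0') := cf x; apply: filterS => y.
rewrite -ltcR; apply: le_lt_trans.
by have := normc_ge_Re (f x - f y); case: (f x) (f y) => [? ?] [].
Qed.

Lemma continuous_Im (R : realType) (f : R -> R[i]) :
  continuous (f : R -> R[i]^o) -> continuous (fun x => complex.Im (f x)).
Proof.
move=> cf x; apply/cvgrPdist_lt => e e0.
have e0' : 0 < (e%:C)%C :> R[i] by rewrite ltcR.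
have /cvgrPdist_lt/(_ _ e0') := cf x; apply: filterS => y.
rewrite -ltcR; apply: le_lt_trans.
by have := normc_ge_Im (f x - f y); case: (f x) (f y) => [? ?] [].
Qed.

Lemma weakly_converges_real (R : realType)
    (nu : nat -> {finite_measure set R -> \bar R})
    (mu : {finite_measure set R -> \bar R}) :
  (forall g : R -> R, continuous g -> (exists M, forall x, `|g x| <= M) ->
    \int[nu k]_x g x @[k --> \oo] --> \int[mu]_x g x) ->
  weakly_converges nu mu.
Proof.
move=> H f cf [M fM]; apply: cvg_complex => /=; apply: H.
- exact: continuous_Re.
- exists M => x; rewrite -lecR; apply: le_trans (fM x); exact: normc_ge_Re.
- exact: continuous_Im.
- exists M => x; rewrite -lecR; apply: le_trans (fM x); exact: normc_ge_Im.
Qed.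

Lemma weakly_converges_Rintegral (R : realType)
    (nu : nat -> {finite_measure set R -> \bar R})
    (mu : {finite_measure set R -> \bar R}) (g : R -> R) :
  weakly_converges nu mu -> continuous g -> (exists M, forall x, `|g x| <= M) ->
  \int[nu k]_x g x @[k --> \oo] --> \int[mu]_x g x.
Proof.
move=> H cg [M gM].
have cgc : continuous ((fun x => (g x)%:C%C) : R -> R[i]^o).
  move=> x; apply/cvgrPdist_lt => -[e e'] /=.
  rewrite ltcE/= => /andP[/eqP -> e0].
  have /cvgrPdist_lt/(_ _ e0) := cg x; apply: filterS => y.
  by rewrite -rmorphB/= normc_def/= expr0n addr0 sqrtr_sqr ltcR.
have := H _ cgc; rewrite /complex_integral/= => /(_ _).
have hM : exists M0 : R, forall x, `|(g x)%:C%C| <= (M0%:C)%C.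
  by exists M => x; rewrite normc_def/= expr0n addr0 sqrtr_sqr lecR.
move=> /(_ hM) cc; apply/cvgrPdist_lt => e e0.
have e0' : 0 < (e%:C)%C :> R[i] by rewrite ltcR.
have /cvgrPdist_lt/(_ _ e0') := cc; apply: filterS => k.
rewrite -ltcR; apply: le_lt_trans.
by rewrite (le_trans _ (normc_ge_Re _))//=.
Qed.

(** * Sufficiency: pointwise convergence of the coding and the law of its limit *)

Lemma cvg_Rintegral_comp (R : realType) (P : probability R R)
    (Xn : nat -> R -> R) (X : R -> R) (g : R -> R) :
  (forall n, measurable_fun setT (Xn n)) -> measurable_fun setT X ->
  (forall w, Xn n w @[n --> \oo] --> X w) ->
  continuous g -> (exists M, forall x, `|g x| <= M) ->
  \int[P]_w g (Xn n w) @[n --> \oo] --> \int[P]_w g (X w).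
Proof.
move=> mXn mX XnX cg [M gM].
have mg : measurable_fun setT g by exact: continuous_measurable_fun.
have [| | | | |iX _ cvg_int] := @dominated_convergence _ _ R P setT measurableT
  (fun n w => (g (Xn n w))%:E) (fun w => (g (X w))%:E) (fun=> M%:E).
- by move=> n; apply/measurable_EFinP; exact: measurableT_comp.
- by apply/measurable_EFinP; exact: measurableT_comp.
- apply: aeW => w _; apply: cvg_EFin; first exact: nearW.
  by apply: continuous_cvg; [exact: cg|exact: XnX].
- exact: finite_measure_integrable_cst.
- by apply: aeW => w n _; rewrite /= lee_fin.
rewrite /Rintegral; apply: fine_cvg.
by rewrite fineK//; exact: integrable_fin_num.
Qed.

Lemma Rintegral_law (R : realType) (P : probability R R)
    (mu : {measure set R -> \bar R}) (X : R -> R) (g : R -> R) :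
  measurable_fun setT X ->
  (forall A, measurable A -> mu A = P (X @^-1` A)) ->
  continuous g -> (exists M, forall x, `|g x| <= M) ->
  \int[mu]_x g x = \int[P]_w g (X w).
Proof.
move=> mX muE cg [M gM].
have mg : measurable_fun setT g by exact: continuous_measurable_fun.
rewrite /Rintegral; congr fine.
rewrite (eq_measure_integral (pushforward P X)).
  rewrite integral_pushforward//=; first exact/measurable_EFinP.
  rewrite preimage_setT; apply: measurable_bounded_integrable => //.
  - by rewrite -ge0_fin_numE ?fin_num_measure.
  - exact: measurableT_comp.
  - exists M; split=> [|r Mr x _ /=]; first exact: num_real.
    exact: le_trans (gM _) (ltW Mr).
by move=> A mA _; exact: muE.
Qed.

Lemma coding_cvg (R : realType) (N : nat -> nat) (s : nat -> R) (w : R) :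
  (forall k, (0 < N k)%N) -> cvgn (series (fun k => `|(N k)%:R * s k|)) ->
  cvgn (fun k => coding N s k w).
Proof.
move=> N_gt0 cNs.
have : cvgn (series (fun i => (digit N i w)%:R * s i)).
  apply: normed_cvg; apply: series_le_cvg cNs => [k|k|k]; rewrite ?normr_ge0//.
  rewrite /= !normrM; apply: ler_wpM2r => //.
  by rewrite !ger0_norm// ler_nat ltnW// ltn_pmod.
move/cvg_ex => [l hl]; apply/cvg_ex; exists l.
(* [coding N s k] has [k + 1] terms, hence the shift with respect to the partial sums. *)
rewrite (_ : (fun k => _) =
    fun k => series (fun i => (digit N i w)%:R * s i) k.+1); last first.
  by apply/funext => k; rewrite /series/= big_mkord.
by rewrite cvg_shiftS.
Qed.

Lemma weakly_converges_of_summable (R : realType) (b : nat -> int)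
    (N : nat -> nat) (t : nat -> int) :
  (forall k, b k != 0) -> (forall k, t k != 0) -> (forall k, (0 < N k)%N) ->
  cvgn (series (fun k => `|(N k)%:R * ((t k)%:~R / base_prod R b k)|)) ->
  exists mu : probability R R, weakly_converges (partial_conv R b N t) mu.
Proof.
move=> b0 t0 N_gt0; set s := fun k => (t k)%:~R / base_prod R b k => cNs.
pose X w := limn (fun k => coding N s k w).
(* The limit exists at every real [w], also outside [[0, 1[], since the digits stay below [N]
   everywhere. *)
have cX w : coding N s k w @[k --> \oo] --> X w by exact: coding_cvg.
have mcoding k := measurable_coding N s k.
have mX : measurable_fun setT X.
  by apply: (measurable_fun_cvg mcoding) => w _; exact: cX.
pose P : probability R R := @unit_law R.
pose X_rv : {RV P >-> R} := mfun_Sub (mem_set mX).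
exists (distribution P X_rv).
apply: weakly_converges_real => g cg gM.
rewrite (Rintegral_law (P := P) mX)//.
rewrite (_ : (fun k => _) = fun k => \int[P]_w g (coding N s k w)).
  exact: cvg_Rintegral_comp.
apply/funext => k; apply: Rintegral_law => // A mA.
have size_gt0 : (0 < size (digit_sums N s k))%N.
  by rewrite size_digit_sums radix_gt0.
(* The partial convolution and the law of [coding N s k] are both uniform on the list
   [digit_sums N s k]. *)
apply: etrans (esym (unit_law_atoms size_gt0 (mcoding k) _ mA)).
  exact: partial_conv_atoms.
by move=> w w01; rewrite size_digit_sums; exact: coding_nth.
Qed.

(** * Necessity: decay of a Laplace transform *)

(** A zero integral would make [f] vanish almost everywhere; as [f] vanishes nowhere, the
    exceptional null set would be the whole line, of mass 1. *)
Lemma Rintegral_gt0 (R : realType) (P : probability R R) (f : R -> R) :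
  measurable_fun setT f -> (forall x, 0 < f x) -> (exists M, forall x, f x <= M) ->
  0 < \int[P]_x f x.
Proof.
move=> mf f0 [M fM].
have mEf : measurable_fun setT (EFin \o f) by exact/measurable_EFinP.
have intf : P.-integrable setT (EFin \o f).
  apply: measurable_bounded_integrable => //.
    by rewrite -ge0_fin_numE ?fin_num_measure.
  exists M; split=> [|r Mr x _ /=]; first exact: num_real.
  by rewrite gtr0_norm// (le_trans (fM x))// ltW.
rewrite lt_neqAle Rintegral_ge0 ?andbT; last by move=> x _; exact/ltW.
apply/eqP => int0.
have : (\int[P]_x `|(EFin \o f) x|)%E = 0%E.
  under eq_integral do rewrite /= gtr0_norm//.
  rewrite -[LHS]fineK; last exact: integrable_fin_num.
  by congr EFin; rewrite int0.
move/(ae_eq_integral_abs P measurableT mEf) => -[A [mA PA0 subA]].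
have : P setT = 0%E.
  apply/eqP; rewrite eq_le measure_ge0 andbT -PA0 le_measure ?inE//.
  move=> x _; apply: subA => /= /(_ I) fx0.
  by have := f0 x; rewrite -lte_fin fx0 ltxx.
by rewrite probability_setT => /eqP; rewrite eqe oner_eq0.
Qed.

(* [expR (- y) <= 1 / (1 + y) <= 1 - y / (1 + n%:R * s)] for [y <= n%:R * s]. *)
Lemma mean_expRN_le (R : realType) (n : nat) (s : R) : (2 <= n)%N -> 0 < s ->
  n%:R^-1 * (\sum_(0 <= j < n) expR (- (j%:R * s))) <=
  1 - n%:R * s / (1 + n%:R * s) / 4.
Proof.
move=> n2 s0; have n2' : 2 <= n%:R :> R by rewrite ler_nat.
have n0 : 0 < n%:R :> R by lra.
set c := n%:R * s; have c0 : 0 < c by rewrite mulr_gt0.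
have le1 (j : nat) : (j < n)%N -> expR (- (j%:R * s)) <= 1 - j%:R * (s / (1 + c)).
  move=> jn; rewrite expRN mulrA; set y := j%:R * s.
  have y0 : 0 <= y by rewrite mulr_ge0// ltW.
  have yc : y <= c by rewrite ler_wpM2r// ?ltW// ltr_nat.
  apply: (@le_trans _ _ (1 + y)^-1).
    by rewrite lef_pV2 ?posrE ?expR_gt0 ?expR_ge1Dx//; lra.
  rewrite -subr_ge0 (_ : _ - _ = y * (c - y) / ((1 + y) * (1 + c))).
    by rewrite divr_ge0// ?mulr_ge0//; lra.
  by field; apply/andP; split; apply/lt0r_neq0; lra.
have sum_id : (\sum_(0 <= j < n) (j%:R : R)) = n%:R * (n%:R - 1) / 2.
  elim: (n) => [|m IHm]; first by rewrite big_nil mul0r mul0r.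
  by rewrite big_nat_recr//= IHm -natr1; field.
apply: (@le_trans _ _ (n%:R^-1 * \sum_(0 <= j < n) (1 - j%:R * (s / (1 + c))))).
  apply: ler_wpM2l; first by rewrite invr_ge0 ltW.
  by apply: ler_sum_nat => j /andP[_]; exact: le1.
rewrite big_split/= sumrN -mulr_suml sum_id big_const_nat subn0 iter_addr_0.
(* The mean of [j] is [(n - 1) / 2], which is at least [n / 4] because [n >= 2]; hence the factor
   4. *)
rewrite -subr_ge0 (_ : _ - _ = (n%:R - 2) * s / (4 * (1 + c))).
  by rewrite divr_ge0// ?mulr_ge0//; lra.
rewrite /c; field; apply/andP; split; apply/lt0r_neq0 => //.
by rewrite -/c; lra.
Qed.

Section laplace.
Variables (R : realType) (N : nat -> nat) (s : nat -> R).
Hypothesis N_ge2 : forall k, (2 <= N k)%N.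
Hypothesis s_gt0 : forall k, 0 < s k.

(** The value at 1 of the Laplace transform of the uniform law on [digit_sums N s k]. *)
Definition laplace k : R :=
  (radix N k)%:R^-1 * \sum_(x <- digit_sums N s k) expR (- x).

Let c k : R := (N k)%:R * s k.
Let gap k : R := c k / (1 + c k) / 4.

Let N_gt0 k : (0 < N k)%N. Proof. exact: leq_trans (N_ge2 k). Qed.

Let c_gt0 k : 0 < c k. Proof. by rewrite mulr_gt0// ltr0n. Qed.

Let gap_ge0 k : 0 <= gap k.
Proof. by rewrite !divr_ge0// ?ltW//; have := c_gt0 k; lra. Qed.

(** Allows [expR (- x)], unbounded on the line, to be replaced on the atoms by the bounded test
    function with [|x|] in place of [x]. *)
Lemma digit_sums_ge0 k x : x \in digit_sums N s k -> 0 <= x.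
Proof.
have dig i y : y \in digits N s i -> 0 <= y.
  by move=> /mapP[j _ ->]; rewrite mulr_ge0// ltW.
elim: k x => [|k IHk] x; first exact: dig.
move=> /allpairsP[[y z] /= [yk zk ->]].
by apply: addr_ge0; [exact: IHk|exact: (dig k.+1)].
Qed.

Lemma laplace_ge0 k : 0 <= laplace k.
Proof. by rewrite mulr_ge0 ?invr_ge0// sumr_ge0// => x _; exact: expR_ge0. Qed.

(** The exponential turns the sum over pairs into a product, whose second factor is the mean bounded
    by [mean_expRN_le]. *)
Lemma laplaceS k : laplace k.+1 <= laplace k * (1 - gap k.+1).
Proof.
have -> : laplace k.+1 = laplace k *
    ((N k.+1)%:R^-1 * (\sum_(0 <= j < N k.+1) expR (- (j%:R * s k.+1)))).
  rewrite /laplace radixS natrM invfM [digit_sums _ _ k.+1]/= big_allpairs_dep.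
  rewrite mulrACA; congr (_ * _); rewrite mulr_suml; apply: eq_bigr => x _.
  rewrite big_map /index_iota subn0 mulr_sumr; apply: eq_bigr => j _.
  by rewrite opprD expRD.
by rewrite ler_wpM2l ?laplace_ge0// mean_expRN_le.
Qed.

Lemma laplace_le1 : laplace 0 <= 1.
Proof.
have -> : laplace 0 = (N 0%N)%:R^-1 * (\sum_(0 <= j < N 0%N) expR (- (j%:R * s 0%N))).
  by rewrite /laplace radix0 big_map /index_iota subn0.
by rewrite (le_trans (mean_expRN_le _ _))//; have := gap_ge0 0; rewrite /gap /c; lra.
Qed.

Lemma summable_of_laplace (l : R) :
  0 < l -> laplace k @[k --> \oo] --> l -> cvgn (series c).
Proof.
move=> l0 cl.
have noninc : {homo laplace : n m / (n <= m)%N >-> m <= n}.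
  apply/nonincreasing_seqP => k; apply: le_trans (laplaceS k) _.
  by have := laplace_ge0 k; have := gap_ge0 k.+1; nra.
have lap_ge k : l <= laplace k.
  by rewrite -(cvg_lim _ cl)//; apply: nonincreasing_cvgn_ge => //; exact: cvgP cl.
(* Each step uses [l * gap n.+1 <= laplace n * gap n.+1 <= laplace n - laplace n.+1]. *)
have sum_le n : l * \sum_(0 <= k < n) gap k.+1 <= 1 - laplace n.
  elim: n => [|n IHn]; first by rewrite big_nil mulr0 subr_ge0 laplace_le1.
  rewrite big_nat_recr//= mulrDr.
  by have := laplaceS n; have := lap_ge n; have := gap_ge0 n.+1; nra.
have cgap : cvgn (series gap).
  (* The telescoped bound starts at [gap 1], so the term of index 0 is set aside. *)
  rewrite -(is_cvg_series_restrict 1%N); apply: nondecreasing_is_cvgn.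
    apply/nondecreasing_seqP => -[|n] /=.
      by rewrite !big_geq.
    by rewrite [leRHS]big_nat_recr//= lerDl.
  exists (1 / l) => _ [[|n] _ <-] /=.
    by rewrite big_geq// divr_ge0// ltW.
  rewrite ler_pdivlMr// mulrC big_add1/= (le_trans (sum_le n))//.
  by rewrite gerBl laplace_ge0.
(* If [gap k < 1 / 8] then [c k / (1 + c k) < 1 / 2], so [c k < 1] and
   [c k / 2 <= c k / (1 + c k) = 4 * gap k]. *)
have /cvgrPdist_lt/(_ 8^-1) := cvg_series_cvg_0 cgap.
case; first by rewrite invr_gt0.
move=> K _ small; rewrite -(is_cvg_series_restrict K).
apply: nondecreasing_is_cvgn.
  apply/nondecreasing_seqP => n /=; have [Kn|nK] := leqP K n.
    by rewrite [leRHS]big_nat_recr//= lerDl ltW.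
  by rewrite !big_geq// ltnW.
have /cvg_seq_bounded/bounded_fun_has_ubound[M gM] := cgap.
(* [M] bounds every partial sum of [gap], and [c k <= 8 * gap k] from index [K] on. *)
exists (8 * M) => _ [n _ <-] /=.
apply: (@le_trans _ _ (8 * series gap n)); last first.
  by rewrite ler_pM2l//; apply: gM; exists n.
rewrite /series/= mulr_sumr.
have [nK|Kn] := leqP n K.
  by rewrite big_geq// sumr_ge0// => k _; rewrite mulr_ge0.
rewrite [leRHS](big_cat_nat (leq0n K) (ltnW Kn))//= -[leLHS]add0r lerD//.
  by rewrite sumr_ge0// => k _; rewrite mulr_ge0.
apply: ler_sum_nat => k /andP[Kk _].
have := small k Kk; rewrite /= sub0r normrN ger0_norm// /gap => gk.
have ck := c_gt0 k.
have ck1 : 0 < 1 + c k by lra.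
have {}gk : c k / (1 + c k) < 2^-1 by lra.
have ck_lt : c k < 1 by move: gk; rewrite ltr_pdivrMr//; lra.
suff : c k / 2 <= c k / (1 + c k) by lra.
by rewrite ler_pM2l// lef_pV2 ?posrE//; lra.
Qed.

End laplace.

Lemma nneseries_lt_pinfty (R : realType) (u : nat -> R) :
  cvgn (series u) -> (\sum_(0 <= k <oo) (u k)%:E < +oo)%E.
Proof.
move=> cu; rewrite (_ : (fun n => _) = EFin \o series u); last first.
  by apply/funext => n; rewrite /= sumEFin.
rewrite (_ : limn _ = (limn (series u))%:E) ?ltry//.
by apply/cvg_lim => //; apply: cvg_EFin; [exact: nearW|].
Qed.

Lemma summable_of_weakly_converges (R : realType) (b : nat -> int)
    (N : nat -> nat) (t : nat -> int) (mu : probability R R) :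
  (forall k, 0 < b k) -> (forall k, 0 < t k) -> (forall k, (2 <= N k)%N) ->
  weakly_converges (partial_conv R b N t) mu ->
  cvgn (series (fun k => (N k)%:R * ((t k)%:~R / base_prod R b k))).
Proof.
move=> b0 t0 N2 wmu; set s := fun k => (t k)%:~R / base_prod R b k.
have s0 k : 0 < s k.
  by rewrite divr_gt0 ?ltr0z// prodr_gt0// => i _; rewrite ltr0z.
(* Being positive everywhere, [f] has a positive integral against [mu], which supplies the limit
   [l > 0]. *)
pose f (x : R) := expR (- `|x|).
have f0 x : 0 < f x by exact: expR_gt0.
have f1 x : f x <= 1 by rewrite -[leRHS]expR0 ler_expR oppr_le0.
have cf : continuous f.
  move=> x; apply: continuous_comp; last exact: continuous_expR.
  by apply: continuousN; exact: norm_continuous.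
have mf : measurable_fun setT f by exact: continuous_measurable_fun.
have cvg_f : \int[partial_conv R b N t k]_x f x @[k --> \oo] --> \int[mu]_x f x.
  apply: weakly_converges_Rintegral => //.
  by exists 1 => x; rewrite gtr0_norm.
apply: (@summable_of_laplace _ _ _ N2 s0 (\int[mu]_x f x)).
  by apply: Rintegral_gt0 => //; exists 1.
rewrite (_ : laplace N s = fun k => \int[partial_conv R b N t k]_x f x)//.
apply/funext => k; rewrite /Rintegral (@ge0_integral_uniform_atoms _ _ (digit_sums N s k)).
- rewrite size_digit_sums sumEFin -EFinM /=; congr (_ * _).
  apply: eq_big_seq => x xk; rewrite /f ger0_norm//.
  exact: digit_sums_ge0 xk.
- apply: partial_conv_atoms => i; exact: lt0r_neq0.
- exact/measurable_EFinP.
- by move=> x; rewrite lee_fin ltW.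
Qed.

(** * Both implications, with sums taken in the extended reals *)

Theorem theorem1p1 (R : realType)
    (b : nat -> int) (N : nat -> nat) (t : nat -> int)
    (b_ge2 : forall k, 2 <= `|b k|)
    (N_ge2 : forall k, (2 <= N k)%N)
    (t_ge1 : forall k, 1 <= `|t k|) :
  ((\sum_(0 <= k <oo)
       (`|(N k)%:R * (t k)%:~R / base_prod R b k|)%:E < +oo)%E ->
   exists mu : probability R R, weakly_converges (partial_conv R b N t) mu)
  /\
  ((forall k, 2 <= b k) -> (forall k, 1 <= t k) ->
   (exists mu : probability R R, weakly_converges (partial_conv R b N t) mu) ->
   (\sum_(0 <= k <oo)
       ((N k)%:R * (t k)%:~R / base_prod R b k)%:E < +oo)%E).
Proof.
have b0 k : b k != 0 by rewrite -normr_gt0 (lt_le_trans _ (b_ge2 k)).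
have t0 k : t k != 0 by rewrite -normr_gt0 (lt_le_trans _ (t_ge1 k)).
split=> [sum_fin|b2 t1 [mu wmu]].
  apply: weakly_converges_of_summable => // [k|]; first exact: leq_trans (N_ge2 k).
  under eq_fun do rewrite mulrA.
  by apply: nnseries_is_cvg sum_fin => k; exact: normr_ge0.
apply: nneseries_lt_pinfty; under eq_fun do rewrite -mulrA.
apply: (summable_of_weakly_converges _ _ N_ge2 wmu) => k.
- exact: lt_le_trans (b2 k).
- exact: lt_le_trans (t1 k).
Qed.
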